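(* Every graph with feedback edge number $1$ has twin-width at most $2$.
   Context: The feedback edge number of a graph $G$ is the minimum size of an edge set $F$ such that $G-F$ is acyclic. Twin-width: in a trigraph (edges colored black or red), contracting two vertices $u,v$ replaces them by a vertex $w$ joined by a black edge to each common black neighbour of $u,v$ and by a red edge to every other neighbour of $u$ or $v$; a contraction sequence of $G$ contracts repeatedly until one vertex remains; its width is the maximum red degree of any vertex in any trigraph of the sequence; the twin-width of $G$ is the minimum width of a contraction sequence of $G$. *)

(* Defs.v *)
From mathcomp Require Import all_boot.

Set Implicit Arguments.
Unset Strict Implicit.
Unset Printing Implicit Defensive.

(* A finite simple graph is a symmetric irreflexive relation e on a finType;
   an edge is an unordered pair of vertices, i.e., a set of size 2. *)

Section FeedbackEdgeNumber.

Variables (V : finType) (e : rel V).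

Definition edges : {set {set V}} := [set [set p.1; p.2] | p in [pred p | e p.1 p.2]].

Definition del_edges (F : {set {set V}}) : rel V :=
  [rel x y | e x y && ([set x; y] \notin F)].

End FeedbackEdgeNumber.

(* Cycles have at least 3 vertices; having pairwise distinct vertices they
   have at most #|V|, which makes the quantification finite (see acyclicP). *)
Definition acyclic (V : finType) (e : rel V) : bool :=
  [forall k : 'I_#|V|.+1, forall c : k.-tuple V, (2 < k) ==> ~~ ucycleb e c].

Definition feedback_edge_set (V : finType) (e : rel V) (F : {set {set V}}) :=
  (F \subset edges e) && acyclic (del_edges e F).

(* edges e is itself a feedback edge set, so the default value of the minimum
   is one of the values over which it ranges (see feedback_edge_numberP). *)
Definition feedback_edge_number (V : finType) (e : rel V) : nat :=
  \big[minn/#|edges e|]_(F : {set {set V}} | feedback_edge_set e F) #|F|.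

(* All trigraphs of a contraction sequence live on the same type V, with a
   decreasing vertex set; see contract for the name of the new vertex. *)
Record trigraph (V : finType) := Trigraph {
  verts : {set V};
  black : rel V;
  red : rel V
}.

Record wf_trigraph (V : finType) (G : trigraph V) : Prop := WfTrigraph {
  black_sym : symmetric (black G);
  red_sym : symmetric (red G);
  black_irr : irreflexive (black G);
  red_irr : irreflexive (red G);
  black_red : forall x y, ~~ (black G x y && red G x y);
  black_verts : forall x y, black G x y -> (x \in verts G) && (y \in verts G);
  red_verts : forall x y, red G x y -> (x \in verts G) && (y \in verts G)
}.

Definition trigraph_of (V : finType) (e : rel V) : trigraph V :=
  Trigraph [set: V] e [rel x y | false].

Section Contraction.

Variables (V : finType) (G : trigraph V) (u v : V).

Definition adj (x y : V) := black G x y || red G x y.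

Definition new_black (y : V) :=
  [&& y != u, y != v, black G u y & black G v y].

Definition new_red (y : V) :=
  [&& y != u, y != v, adj u y || adj v y & ~~ (black G u y && black G v y)].

(* The vertex w that replaces u and v is given the name u, which is free once
   u and v are removed. *)
Definition contract : trigraph V :=
  Trigraph (verts G :\ v)
    [rel x y | if x == u then new_black y else if y == u then new_black x
               else [&& x != v, y != v & black G x y]]
    [rel x y | if x == u then new_red y else if y == u then new_red x
               else [&& x != v, y != v & red G x y]].

End Contraction.

Definition red_degree (V : finType) (G : trigraph V) (x : V) : nat :=
  #|[set y in verts G | red G x y]|.

Definition max_red_degree (V : finType) (G : trigraph V) : nat :=
  \max_(x in verts G) red_degree G x.

(* A contraction sequence is encoded by its list of contracted pairs. *)
Fixpoint contraction_sequence (V : finType) (G : trigraph V)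
    (s : seq (V * V)) : bool :=
  if s is (u, v) :: s' then
    [&& u \in verts G, v \in verts G, u != v
      & contraction_sequence (contract G u v) s']
  else #|verts G| == 1.

Fixpoint width (V : finType) (G : trigraph V) (s : seq (V * V)) : nat :=
  if s is (u, v) :: s' then
    maxn (max_red_degree G) (width (contract G u v) s')
  else max_red_degree G.

(* A contraction sequence has exactly #|V| - 1 steps and its width is at most
   #|V|, hence the index type and the default value of the minimum
   (see contraction_sequence_size and twin_widthP). *)
Definition twin_width (V : finType) (e : rel V) : nat :=
  \big[minn/#|V|]_(s : #|V|.-1.-tuple (V * V)
                   | contraction_sequence (trigraph_of e) s)
    width (trigraph_of e) s.

Lemma acyclicP (V : finType) (e : rel V) :
  reflect (forall c : seq V, 2 < size c -> ~ ucycle e c) (acyclic e).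
Proof.
apply: (iffP forallP) => [H c c2 cyc | H k].
  have cV : size c < #|V|.+1.
    by rewrite ltnS; case/andP: cyc => _ /card_uniqP <-; apply: max_card.
  have /forallP/(_ (in_tuple c)) := H (Ordinal cV).
  by rewrite /= c2 /=; move/negP; apply.
apply/forallP => c; apply/implyP => k2; apply/negP => cyc.
by apply: (H c) => //; rewrite size_tuple.
Qed.

Lemma bigmin_attained (I : finType) (P : pred I) (f : I -> nat) (x : nat) :
  (exists2 i, P i & f i <= x) ->
  exists2 i, P i & \big[minn/x]_(j | P j) f j = f i /\
                   forall j, P j -> f i <= f j.
Proof.
case=> i0 Pi0 fi0.
case: (arg_minnP f Pi0) => i Pi imin; exists i => //; split => //.
apply/eqP; rewrite eqn_leq; apply/andP; split.
  have: i \in index_enum I by rewrite mem_index_enum.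
  elim: (index_enum I) => // j r IH; rewrite inE big_cons.
  case/orP => [/eqP <-|/IH le]; first by rewrite Pi geq_minl.
  by case: ifP => // _; apply: leq_trans (geq_minr _ _) le.
apply: (big_ind (fun n => f i <= n)) => //.
- exact: leq_trans (imin _ Pi0) fi0.
- by move=> m n Hm Hn; rewrite leq_min Hm.
Qed.

Lemma feedback_edge_set_edges (V : finType) (e : rel V) :
  feedback_edge_set e (edges e).
Proof.
rewrite /feedback_edge_set subxx; apply/acyclicP => -[|x [|y c]] // _.
case/andP=> /andP[/andP[exy]] /negP[]; apply/imsetP.
by exists (x, y).
Qed.

Lemma feedback_edge_numberP (V : finType) (e : rel V) :
  exists2 F, feedback_edge_set e F & feedback_edge_number e = #|F| /\
    forall F', feedback_edge_set e F' -> #|F| <= #|F'|.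
Proof.
apply: bigmin_attained; exists (edges e) => //.
exact: feedback_edge_set_edges.
Qed.

Lemma wf_trigraph_of (V : finType) (e : rel V) :
  symmetric e -> irreflexive e -> wf_trigraph (trigraph_of e).
Proof. by move=> s i; split => //= x y; rewrite ?andbF // !inE. Qed.

Lemma wf_contract (V : finType) (G : trigraph V) (u v : V) :
  u \in verts G -> v \in verts G -> u != v ->
  wf_trigraph G -> wf_trigraph (contract G u v).
Proof.
move=> uG vG uv [bs rs bi ri br bv rv].
have nbP y : new_black G u v y -> (y != v) && (y \in verts G).
  by case/and4P=> _ -> /bv/andP[_ ->] _.
have nrP y : new_red G u v y -> (y != v) && (y \in verts G).
  case/and4P=> _ -> + _.
  by case/orP=> /orP[/bv|/rv]/andP[_ ->].
have nbr y : ~~ (new_black G u v y && new_red G u v y).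
  by apply/negP => /andP[/and4P[_ _ bu bw] /and4P[_ _ _]]; rewrite bu bw.
split => /=.
- move=> x y /=; have [xu|xu] := eqVneq x u; have [yu|yu] := eqVneq y u; rewrite ?xu ?yu //.
  by rewrite bs andbCA.
- move=> x y /=; have [xu|xu] := eqVneq x u; have [yu|yu] := eqVneq y u; rewrite ?xu ?yu //.
  by rewrite rs andbCA.
- move=> x /=; case: eqP => [->|_]; first by rewrite /new_black eqxx.
  by rewrite bi !andbF.
- move=> x /=; case: eqP => [->|_]; first by rewrite /new_red eqxx.
  by rewrite ri !andbF.
- move=> x y /=; case: ifP => _ //; case: ifP => _ //.
  by apply: contra (br x y) => /andP[/and3P[_ _ ->] /and3P[_ _ ->]].
- move=> x y /=; rewrite !inE; case: eqP => [->|_].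
    by move/nbP => ->; rewrite uv uG.
  case: eqP => [->|_]; first by move/nbP => ->; rewrite uv uG.
  by case/and3P=> -> -> /bv.
- move=> x y /=; rewrite !inE; case: eqP => [->|_].
    by move/nrP => ->; rewrite uv uG.
  case: eqP => [->|_]; first by move/nrP => ->; rewrite uv uG.
  by case/and3P=> -> -> /rv.
Qed.

Lemma contraction_sequence_size (V : finType) (G : trigraph V) s :
  contraction_sequence G s -> size s = #|verts G|.-1.
Proof.
elim: s G => [|[u v] s IH] G /=; first by move/eqP->.
case/and4P=> uG vG uv /IH ->; rewrite /= [in RHS](cardsD1 v) vG /=.
rewrite prednK // card_gt0; apply/set0Pn; exists u.
by rewrite !inE uv uG.
Qed.

Lemma contraction_sequence_exists (V : finType) (G : trigraph V) :
  0 < #|verts G| -> exists s, contraction_sequence G s.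
Proof.
move En: #|verts G| => [//|n] _; elim: n G En => [|n IH] G En.
  by exists [::]; rewrite /= En.
have /card_gt1P[u [v [uG vG uv]]] : 1 < #|verts G| by rewrite En.
have [|s Hs] := IH (contract G u v).
  by move: En; rewrite (cardsD1 v) vG add1n => -[].
by exists ((u, v) :: s); rewrite /= uG vG uv.
Qed.

Lemma width_le_card (V : finType) (G : trigraph V) s : width G s <= #|V|.
Proof.
have H (G' : trigraph V) : max_red_degree G' <= #|V|.
  by apply/bigmax_leqP => x _; apply: max_card.
by elim: s G => [|[u v] s IH] G /=; rewrite ?geq_max ?H ?IH.
Qed.

Lemma twin_widthP (V : finType) (e : rel V) : 0 < #|V| ->
  exists2 s, contraction_sequence (trigraph_of e) s &
    twin_width e = width (trigraph_of e) s /\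
    forall s', contraction_sequence (trigraph_of e) s' ->
      width (trigraph_of e) s <= width (trigraph_of e) s'.
Proof.
move=> V0.
have sz s : contraction_sequence (trigraph_of e) s -> size s == #|V|.-1.
  by move/contraction_sequence_size ->; rewrite cardsT.
have [|s0 Hs0] := @contraction_sequence_exists V (trigraph_of e).
  by rewrite cardsT.
have [|s Hs [Es smin]] := @bigmin_attained _
  (fun s : #|V|.-1.-tuple (V * V) => contraction_sequence (trigraph_of e) s)
  (fun s => width (trigraph_of e) s) #|V|.
  by exists (Tuple (sz _ Hs0)); rewrite ?width_le_card.
exists s => //; split => // s' Hs'.
exact: (smin (Tuple (sz _ Hs'))).
Qed.

(* Main.v *)
(** Deleting the feedback edge ab leaves a forest.  Root it at a and add the arc
    from a to b: the edges of the graph are then among the pairs {x, p x} of a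
    function p whose only cycle K passes through a.  Since every edge at a newly
    contracted vertex may be assumed red, such an upper bound on the edges, with
    a set of possibly red ones, is all that has to be maintained.

    The trees hanging off K are first shrunk to at most one pendant vertex per
    vertex of K: merge two leaves with the same parent if there are any, and
    otherwise contract a deepest leaf into its parent.  The pendant vertex at a is
    then contracted into a.  From there on both cycle edges at a are red, and one
    alternately contracts a with the pendant vertex of p a, which only has the
    neighbour p a of a, and a with p a itself, which shortens the cycle. *)

Require Import Defs.
From mathcomp Require Import all_boot.

Set Implicit Arguments.
Unset Strict Implicit.
Unset Printing Implicit Defensive.

(** * Leaves and parent pointers in a forest *)

Section RootedForest.

Variables (V : finType) (T : rel V).
Hypotheses (T_sym : symmetric T) (T_irr : irreflexive T) (T_acyc : acyclic T).

(** Otherwise every vertex of [S] other than [a] has two neighbours in [S], and a path in [S] can be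
    prolonged at its head for ever, since a second neighbour of the head lying on the path would
    close a cycle. *)
Lemma acyclic_leaf (S : {set V}) (a : V) : a \in S -> 1 < #|S| ->
  exists2 v, v \in S :\ a &
    {in S &, forall y z, T v y -> T v z -> y = z}.
Proof.
move=> aS S1.
case: (boolP [exists v in S :\ a, [forall y in S, forall z in S,
    T v y ==> T v z ==> (y == z)]]).
  case/existsP=> v /andP[vS /forall_inP H]; exists v => // y z yS zS Ty Tz.
  by have /forall_inP/(_ z zS) := H y yS; rewrite Ty Tz => /eqP.
move=> /existsPn noleaf.
have branch v y : v \in S -> v != a -> exists2 z, z \in S & T v z && (z != y).
  move=> vS va; have := noleaf v; rewrite !inE va vS /=.
  case/forallPn=> z1; rewrite negb_imply => /andP[z1S /forallPn[z2]].
  rewrite !negb_imply => /and4P[z2S T1 T2 z12].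
  have [E|z1y] := eqVneq z1 y; last by exists z1 => //; rewrite T1.
  by exists z2; rewrite // T2 -E eq_sym.
have grow n : exists x y s, [/\ size s = n, uniq [:: x, y & s],
    path T x (y :: s), all [in S] [:: x, y & s] &
    x != a /\ (a \in y :: s \/ {in S, forall z, ~~ T z a})].
  elim: n => [|n [x [y [s [sz un pa al [xa Ha]]]]]].
    case: (boolP [exists x in S, T x a]) => [/exists_inP[x xS Txa]|].
      have xa : x != a by apply: contraTneq Txa => ->; rewrite T_irr.
      exists x, a, [::]; split; rewrite /= ?inE ?xa ?Txa ?xS ?aS //.
      by split=> //; left; rewrite eqxx.
    move=> /exists_inPn iso.
    have /card_gt0P[x] : 0 < #|S :\ a| by move: S1; rewrite (cardsD1 a) aS.
    rewrite !inE => /andP[xa xS].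
    have [z zS /andP[Tz zx]] := branch x x xS xa.
    exists x, z, [::]; split; last by split=> //; right.
    - by [].
    - by rewrite /= inE eq_sym zx.
    - by rewrite /= Tz.
    - by rewrite /= xS zS.
  have xS : x \in S by case/andP: al.
  have [z zS /andP[Tz zy]] := branch x y xS xa.
  have zx : z != x by apply: contraTneq Tz => ->; rewrite T_irr.
  (* If [z] lies on the path, the segment from [x] to [z] closes into a cycle; it has at least three
     vertices because [z] differs from [y]. *)
  have [zs|zs] := boolP (z \in s).
    have /acyclicP noc := T_acyc.
    case/splitPr: zs un pa => s1 s2 un pa.
    case: (noc [:: x, y & rcons s1 z]); first by rewrite /= size_rcons.
    move: un pa; rewrite -cat_rcons -!cat_cons cat_uniq => /andP[un _].
    rewrite cat_path => /andP[pa _].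
    apply/andP; split; last exact: un.
    by rewrite /cycle rcons_path pa /= last_rcons T_sym.
  exists z, x, (y :: s); split; rewrite /= ?sz //.
  - by move: un; rewrite /= !inE (negPf zx) (negPf zy) (negPf zs) /= => ->.
  - by rewrite T_sym Tz.
  - by rewrite zS.
  split; last by case: Ha => Ha; [left; rewrite inE Ha orbT | right].
  case: Ha => Ha; last by apply: contraTneq Tz => ->; apply: Ha.
  by apply: contraTneq Ha => <-; rewrite inE negb_or zy.
have [x [y [s [sz un _ _ _]]]] := grow #|V|.
by have := max_card [in [:: x, y & s]]; rewrite (card_uniqP un) /= sz ltnNge leqnSn.
Qed.

(* Only an upper bound on the edges: vertices outside the component of [a] also
   get a parent, so the parent pointers form one tree with root [a]. *)
Lemma acyclic_parent (a : V) : exists (q : V -> V) (d : V -> nat),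
  (forall x, x != a -> d (q x) < d x) /\
  (forall x y, T x y -> (x != a /\ q x = y) \/ (y != a /\ q y = x)).
Proof.
(* Relativised to a set containing [a], so that leaves can be stripped one by one. Closure under [q]
   ensures that no remaining vertex has the stripped leaf as parent, so old depths stay valid. *)
suff [q [d [Hd _ HT]]] : exists (q : V -> V) (d : V -> nat),
   [/\ {in [set: V], forall x, x != a -> d (q x) < d x},
    {in [set: V], forall x, q x \in [set: V]} &
    {in [set: V] &, forall x y,
      T x y -> (x != a /\ q x = y) \/ (y != a /\ q y = x)}].
  by exists q, d; split=> [x|x y]; [apply: Hd | apply: HT].
move: [set: V] (in_setT a) => S aS.
move En: #|S| => n; elim: n S En aS => [|n IH] S En aS.
  by move: aS; rewrite (cards0_eq En) inE.
case: (posnP n) => [n0|n_gt0].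
  have SaP x : x \in S -> x = a.
    have /eqP/cards1P[z Sz] : #|S| = 1 by rewrite En n0.
    by move: aS; rewrite Sz !inE => /eqP -> /eqP.
  exists id, (fun=> 0); split=> // [x /SaP ->|x y /SaP -> /SaP ->].
    by rewrite eqxx.
  by rewrite T_irr.
have [|v] := acyclic_leaf aS; first by rewrite En.
rewrite !inE => /andP[va vS] leaf.
have aS' : a \in S :\ v by rewrite !inE eq_sym va.
have [|q [d [Hd Hq HT]]] := IH (S :\ v) _ aS'.
  by move: En; rewrite (cardsD1 v) vS => -[].
(* [w] becomes the parent of [v]: its only neighbour in [S] if there is one, and [a] otherwise. *)
have [w wS' Hw] : exists2 w, w \in S :\ v & {in S, forall y, T v y -> y = w}.
  case: (boolP [exists w in S, T v w]) => [/exists_inP[w wS Tw]|/exists_inPn no].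
    exists w; last by move=> y yS Ty; apply: leaf.
    by rewrite !inE wS andbT; apply: contraTneq Tw => ->; rewrite T_irr.
  by exists a => // y /no /negP.
have wv : w == v = false by move: wS'; rewrite !inE; case: eqP.
exists (fun x => if x == v then w else q x),
       (fun x => if x == v then (d w).+1 else d x); split.
- move=> x xS xa; case: (x =P v) => [_|/eqP xv]; first by rewrite wv.
  have xS' : x \in S :\ v by rewrite !inE xv.
  by have := Hq _ xS'; rewrite !inE => /andP[/negPf -> _]; apply: Hd.
- move=> x xS; case: eqP => [_|/eqP xv]; first by case/setD1P: wS'.
  by have /setD1P[] : q x \in S :\ v by apply: Hq; rewrite !inE xv.
- move=> x y xS yS Txy.
  case: (x =P v) => [xv|/eqP xv]; first by left; rewrite xv (Hw y) // -xv.
  case: (y =P v) => [yv|/eqP yv].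
    by right; rewrite yv (Hw x) // -yv T_sym.
  by apply: HT; rewrite // !inE ?xv ?yv.
Qed.

End RootedForest.

Definition sequence_of_width (V : finType) (k : nat) (G : trigraph V) : Prop :=
  exists2 s, contraction_sequence G s & width G s <= k.

(** * Contractions under an upper bound on the edges *)

Section Reduction.

Variable V : finType.
Implicit Types (G : trigraph V) (p : V -> V) (d : V -> nat) (K r : {set V}).

Lemma sequence_of_width1 G k a : verts G = [set a] ->
  (forall x, x \in verts G -> red_degree G x <= k) -> sequence_of_width k G.
Proof.
by move=> Ga Gk; exists [::]; [rewrite /= Ga cards1 | apply/bigmax_leqP].
Qed.

Lemma sequence_of_width_contract G k u v :
  u \in verts G -> v \in verts G -> u != v ->
  (forall x, x \in verts G -> red_degree G x <= k) ->
  sequence_of_width k (contract G u v) -> sequence_of_width k G.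
Proof.
move=> uG vG uv Gk [s Hs Ws]; exists ((u, v) :: s); rewrite /= ?uG ?vG ?uv //.
by rewrite geq_max Ws andbT; apply/bigmax_leqP.
Qed.

Lemma card_sub_set2 (A : {set V}) x y : A \subset [set x; y] -> #|A| <= 2.
Proof. by move/subset_leq_card/leq_trans; apply; rewrite cards2; case: eqP. Qed.

(* [r] marks the vertices whose edge to the parent may be red. *)
Record bounded G p r : Prop := Bounded {
  red_irrefl : irreflexive (red G);
  parent_verts : {in verts G, forall x, p x \in verts G};
  adj_parent : {in verts G &, forall x y, x != y -> adj G x y ->
    p x = y \/ p y = x};
  red_parent : {in verts G &, forall x y, x != y -> red G x y ->
    (x \in r /\ p x = y) \/ (y \in r /\ p y = x)}
}.

(* The new vertex [u] may only get red edges, so black edges play no role. *)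
Lemma bounded_contract G p r u v p' r' :
  bounded G p r -> u \in verts G -> v \in verts G ->
  {in verts G :\ v, forall x, p' x \in verts G :\ v} ->
  {in verts G :\ v, forall x, x != u -> p x != v -> p' x = p x} ->
  {in verts G :\ v, forall x, x != u -> x \in r -> x \in r'} ->
  {in verts G :\ v, forall y, y != u ->
    [\/ p u = y, p y = u, p v = y | p y = v] ->
    (u \in r' /\ p' u = y) \/ (y \in r' /\ p' y = u)} ->
  bounded (contract G u v) p' r'.
Proof.
move=> [irr pG adjP redP] uG vG p'G p'p rr' Hu.
have new_adj y : y \in verts G :\ v -> y != u -> adj G u y || adj G v y ->
    (u \in r' /\ p' u = y) \/ (y \in r' /\ p' y = u).
  move=> yG yu; have [yv yG0] := setD1P yG; case/orP => A; apply: Hu => //.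
    by have [] := adjP u y uG yG0 _ A; rewrite 1?eq_sym // => E;
      [apply: Or41 | apply: Or42].
  by have [] := adjP v y vG yG0 _ A; rewrite 1?eq_sym // => E;
    [apply: Or43 | apply: Or44].
have nbA y : new_black G u v y -> adj G u y || adj G v y.
  by rewrite /adj => /and4P[_ _ ->].
have nrA y : new_red G u v y -> adj G u y || adj G v y by case/and4P.
have keep x y : x \in verts G :\ v -> y \in verts G :\ v -> x != u ->
    p x = y -> p' x = y.
  by move=> xG /setD1P[yv _] xu E; rewrite p'p ?E.
split=> //=; first by move=> x /=; case: eqP => [->|_];
  rewrite ?irr ?andbF // /new_red eqxx.
all: move=> x y xG yG xy.
- rewrite {1}/adj /=; case: (eqVneq x u) => [xu|xu].
    rewrite xu => /orP[/nbA|/nrA] /new_adj;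
      by rewrite -xu eq_sym xy yG => /(_ isT isT) []; tauto.
  case: (eqVneq y u) => [yu|yu].
    rewrite yu => /orP[/nbA|/nrA] /new_adj;
      by rewrite xu xG => /(_ isT isT) []; tauto.
  move: (xG) (yG) => /setD1P[xv xG0] /setD1P[yv yG0].
  rewrite xv yv /= => A.
  by have [E|E] := adjP x y xG0 yG0 xy A; [left|right]; apply: keep.
- case: (eqVneq x u) => [xu|xu].
    rewrite xu => /nrA /new_adj.
    by rewrite -xu eq_sym xy yG => /(_ isT isT) []; tauto.
  case: (eqVneq y u) => [yu|yu].
    rewrite yu => /nrA /new_adj.
    by rewrite xu xG => /(_ isT isT) []; tauto.
  move: (xG) (yG) => /setD1P[xv xG0] /setD1P[yv yG0].
  rewrite xv yv /= => A.
  by have [[rE E]|[rE E]] := redP x y xG0 yG0 xy A; [left|right];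
    split; [apply: rr' | apply: keep | apply: rr' | apply: keep].
Qed.

(** [p] permutes the finite set [K], and the depth drops everywhere except at [a]. Hence every orbit
    in [K] passes through [a], and [K] is a single cycle, possibly of length one or two. *)
Record core G p K a d : Prop := Core {
  core_verts : {subset K <= verts G};
  root_core : a \in K;
  core_parent : {in K, forall x, p x \in K};
  core_inj : {in K &, injective p};
  depth_parent : {in verts G, forall x, x != a -> d (p x) < d x}
}.

Lemma core_contract G p K a d u v : v \notin K ->
  core G p K a d -> core (contract G u v) p K a d.
Proof.
move=> vK [KG aK pK injp dp]; split=> //= [x xK|x /setD1P[_]]; last exact: dp.
by rewrite !inE KG // andbT; apply: contraNneq vK => <-.
Qed.

(** These parent edges are the pendant ones and the two cycle edges at [a]. *)
Definition sun_red p K a := [set x | [|| x \notin K, x == a | p x == a]].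

(* A cycle [K] through [a] in which every vertex except [a] has at most one
   pendant neighbour. *)
Record sun G p K a d : Prop := Sun {
  sun_core : core G p K a d;
  sun_parent : {in verts G, forall x, p x \in K};
  sun_pendant_inj : {in verts G :\: K &, injective p};
  sun_pendant_root : {in verts G :\: K, forall x, p x != a};
  sun_bounded : bounded G p (sun_red p K a)
}.

(** A pendant vertex sees only its parent, and [a] only its two cycle neighbours. Any other vertex
    of [K] has red edges at most to its one pendant vertex and to [a]. *)
Lemma sun_red_degree G p K a d : sun G p K a d ->
  forall x, x \in verts G -> red_degree G x <= 2.
Proof.
case=> -[KG aK pK injp dp] pGK injL La [irr _ _ redP] x xG.
have nbr y : y \in [set y in verts G | red G x y] ->
    y \in verts G /\ ((x \in sun_red p K a /\ p x = y) \/
                     (y \in sun_red p K a /\ p y = x)).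
  rewrite inE => /andP[yG rxy]; split=> //; apply: redP => //.
  by apply: contraTneq rxy => ->; rewrite irr.
have [xK|xK] := boolP (x \in K); last first.
  apply: (@card_sub_set2 _ (p x) (p x)); apply/subsetP => y /nbr[yG].
  case=> -[_ E]; first by rewrite E !inE eqxx.
  by move: xK; rewrite -E pGK.
have [xa|xa] := eqVneq x a.
  have [c Hc] : exists c, {in verts G, forall y, p y = a -> y = c}.
    case: (pickP [pred y in K | p y == a]) => [c /andP[cK /eqP pc]|none].
      exists c => y yG py; apply: injp => //; last by rewrite py.
      by apply: contraT => yK; have := La y; rewrite py eqxx !inE yG yK => /(_ isT).
    exists a => y yG py; have := none y; rewrite /= py eqxx andbT => yK.
    by have := La y; rewrite !inE yG yK py eqxx => /(_ isT).
  apply: (@card_sub_set2 _ (p x) c); apply/subsetP => y /nbr[yG].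
  case=> -[_ E]; first by rewrite E !inE eqxx.
  by rewrite !inE (Hc y) ?eqxx ?orbT // E.
have [l Hl] : exists l, {in verts G :\: K, forall y, p y = x -> y = l}.
  case: (pickP [pred y in verts G :\: K | p y == x]) => [l /andP[lG /eqP pl]|none].
    by exists l => y yG py; apply: injL => //; rewrite py.
  by exists a => y yG py; have := none y; rewrite /= yG py eqxx.
apply: (@card_sub_set2 _ a l); apply/subsetP => y /nbr[yG].
case=> -[]; rewrite !inE.
  by rewrite xK (negPf xa) /= => /eqP -> ->; rewrite eqxx.
move=> + E; rewrite E (negPf xa) orbF => /orP[yK|->//].
by rewrite (Hl y) ?inE ?yK ?eqxx ?orbT.
Qed.

Lemma sun_sequence G p K a d : sun G p K a d -> sequence_of_width 2 G.
Proof.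
move En: #|verts G| => n; elim: n G p K En => [|n IH] G p K En sG.
  case: sG => -[KG aK _ _ _] _ _ _ _; have /card_gt0P : 0 < #|verts G|.
    by apply/card_gt0P; exists a; apply: KG.
  by rewrite (cards0_eq En) => -[x]; rewrite inE.
have deg := sun_red_degree sG.
case: sG => cG pGK injL La bG; have [KG aK pK injp dp] := cG.
have aG := KG _ aK.
have Lout x y : x \in verts G -> y \notin K -> p x != y.
  by move=> xG; apply: contraNneq => <-; apply: pGK.
(* The cycle is a loop at [a]. By induction on depth, any further vertex would have parent [a], but
   [a] has no pendant vertex and [p] is injective on [K]. *)
have [ba|ba] := eqVneq (p a) a.
  suff Ga : verts G = [set a] by apply: sequence_of_width1 Ga deg.
  apply/setP => x; rewrite !inE; apply/idP/eqP => [|->//].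
  have [k] := ubnP (d x); elim: k x => // k IHk x dxk xG.
  apply/eqP; apply: contraT => xa.
  have px : p x = a by apply: IHk; [apply: leq_trans (dp x xG xa) _ | apply: KG; apply: pGK].
  have [xK|xK] := boolP (x \in K).
    by rewrite (injp x a) ?eqxx ?px ?ba in xa.
  by have := La x; rewrite !inE xK xG px eqxx => /(_ isT).
case: (pickP [pred l in verts G :\: K | p l == p a]) => [l|noleaf].
  rewrite !inE => /andP[/andP[lK lG] /eqP pl].
  have al : a != l by apply: contraNneq lK => <-.
  apply: (sequence_of_width_contract aG lG al deg); apply: (IH _ p K).
    by move: En; rewrite (cardsD1 l) lG => -[].
  split; rewrite /=.
  - exact: core_contract.
  - by move=> x /setD1P[_]; apply: pGK.
  - move=> x y; rewrite !inE => /and3P[xK _ xG] /and3P[yK _ yG].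
    by apply: injL; rewrite !inE ?xK ?yK.
  - by move=> x; rewrite !inE => /and3P[xK _ xG]; apply: La; rewrite !inE xK.
  apply: (bounded_contract bG) => //=.
  - by move=> x /setD1P[_ xG]; rewrite !inE Lout // KG // pGK.
  move=> y /setD1P[yl yG] ya; rewrite !inE eqxx orbT.
  case=> E; [by left | by right; rewrite E eqxx !orbT | by left; rewrite -pl |].
  by have := Lout y l yG lK; rewrite E eqxx.
have bK := pK _ aK; have bG' := KG _ bK.
have ab : a != p a by rewrite eq_sym.
apply: (sequence_of_width_contract aG bG' ab deg).
(* As [p a] has no pendant vertex, [a] is its only child, so bypassing [p a] redirects [a] alone.
   Depths survive because they do not constrain [a]; a cycle of length two becomes a loop. *)
pose p' x := if x == a then p (p a) else p x.
have pb x : x \in verts G -> x != a -> p x != p a.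
  move=> xG; apply: contraNneq => E; have [xK|xK] := boolP (x \in K).
    by apply/eqP/injp.
  by have := noleaf x; rewrite /= !inE xK xG E eqxx.
have p'P x : x \in verts G -> p' x \in K :\ p a.
  move=> xG; rewrite /p' !inE; case: (eqVneq x a) => [_|xa].
    by rewrite pb ?pK.
  by rewrite pb ?pGK.
have LK x : x \in verts G :\ p a -> x \notin K :\ p a -> (x != a) && (x \notin K).
  by rewrite !inE => /andP[-> _] xK; rewrite andbC xK; apply: contraNneq xK => ->.
apply: (IH _ p' (K :\ p a)).
  by move: En; rewrite (cardsD1 (p a)) bG' => -[].
split; rewrite /=.
- split=> //=.
  + by move=> x; rewrite !inE => /andP[-> /KG].
  + by rewrite !inE ab.
  + by move=> x /setD1P[_ /KG]; apply: p'P.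
  + move=> x y; rewrite !inE /p' => /andP[xb xK] /andP[yb yK].
    case: (eqVneq x a) => [->|xa]; case: (eqVneq y a) => [->|ya] // /injp.
    * by move=> E; rewrite E ?eqxx in yb.
    * by move=> E; rewrite E ?eqxx in xb.
    * exact.
  by move=> x /setD1P[xb xG] xa; rewrite /p' (negPf xa) dp.
- by move=> x /setD1P[_]; apply: p'P.
- move=> x y /setDP[xG xK] /setDP[yG yK].
  have /andP[xa xK0] := LK x xG xK; have /andP[ya yK0] := LK y yG yK.
  rewrite /p' (negPf xa) (negPf ya); apply: injL; rewrite !inE ?xK0 ?yK0.
    by case/setD1P: xG.
  by case/setD1P: yG.
- move=> x /setDP[xG xK]; have /andP[xa xK0] := LK x xG xK.
  by rewrite /p' (negPf xa); apply: La; case/setD1P: xG => _ xG; rewrite !inE xK0.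
apply: (bounded_contract bG) => //=.
- by move=> x /setD1P[_ /p'P]; rewrite !inE => /andP[-> /KG].
- by move=> x _ /negPf xa _; rewrite /p' xa.
- by move=> x /setD1P[xb xG] xa; rewrite !inE xb (negPf xa) /= /p' (negPf xa).
move=> y /setD1P[yb yG] ya; rewrite !inE eqxx orbT /p' eqxx (negPf ya).
case=> E.
- by rewrite E eqxx in yb.
- by right; rewrite E eqxx !orbT.
- by left.
- by have := pb y yG ya; rewrite E eqxx.
Qed.

(** * Shrinking the trees that hang off the cycle *)

Definition leaf G p K x :=
  (x \in verts G :\: K) && [forall y in verts G, p y != x].

Lemma leafP G p K x : reflect
  [/\ x \in verts G, x \notin K & {in verts G, forall y, p y != x}]
  (leaf G p K x).
Proof.
rewrite /leaf inE; apply: (iffP andP).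
  by case=> /andP[xK xG] /forall_inP.
by case=> -> -> H; split=> //; apply/forall_inP.
Qed.

(** Only parent edges of leaves may be red, with at most two under each parent. A leaf then has red
    degree at most one, any other vertex at most two. *)
Record hairy G p K a d r : Prop := Hairy {
  hairy_core : core G p K a d;
  hairy_leaf : {in r, forall x, leaf G p K x};
  hairy_card : forall y, #|[set x in r | p x == y]| <= 2;
  hairy_bounded : bounded G p r
}.

Lemma hairy_red_degree G p K a d r : hairy G p K a d r ->
  forall x, x \in verts G -> red_degree G x <= 2.
Proof.
case=> _ rL rC [irr _ _ redP] x xG.
have nbr y : y \in [set y in verts G | red G x y] ->
    y \in verts G /\ ((x \in r /\ p x = y) \/ (y \in r /\ p y = x)).
  rewrite inE => /andP[yG rxy]; split=> //; apply: redP => //.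
  by apply: contraTneq rxy => ->; rewrite irr.
have [xr|xr] := boolP (x \in r).
  apply: (@card_sub_set2 _ (p x) (p x)); apply/subsetP => y /nbr[yG].
  case=> -[_ E]; first by rewrite E !inE eqxx.
  by have /leafP[_ _ /(_ y yG)] := rL x xr; rewrite E eqxx.
apply: leq_trans (rC x); apply/subset_leq_card/subsetP => y /nbr[yG].
by case=> -[yr E]; [rewrite yr in xr | rewrite inE yr E eqxx].
Qed.

(** Chooses which sibling leaves to merge: with [A] the red leaves under a parent and [P] all leaves
    there, the chosen pair covers every red one. *)
Lemma card2_extend (A : {set V}) (P : pred V) x y :
  #|A| <= 2 -> {in A, forall z, P z} -> P x -> P y -> x != y ->
  exists u v, [/\ P u, P v, u != v & A \subset [set u; v]].
Proof.
move=> A2 AP Px Py xy.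
have [Axy|/subsetPn[z zA]] := boolP (A \subset [set x; y]); first by exists x, y.
rewrite !inE negb_or => /andP[zx zy].
have [Azx|/subsetPn[t tA]] := boolP (A \subset [set z; x]).
  by exists z, x; rewrite AP.
rewrite !inE negb_or => /andP[tz _]; exists z, t; rewrite !AP // eq_sym tz.
split=> //; suff /eqP -> : [set z; t] == A by [].
rewrite eqEcard cards2 eq_sym tz A2 andbT.
by apply/subsetP => w; rewrite !inE => /orP[] /eqP ->.
Qed.

(** Both leaves see only their common parent, so the merged vertex is again a leaf there. Since the
    pair covered all red leaves under that parent, it is the only red one left. *)
Lemma hairy_merge G p K a d r u v : hairy G p K a d r ->
  leaf G p K u -> leaf G p K v -> u != v -> p u = p v ->
  [set x in r | p x == p u] \subset [set u; v] ->
  hairy (contract G u v) p K a d (u |: r :\ v).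
Proof.
case=> cG rL rC bG /leafP[uG uK Lu] /leafP[vG vK Lv] uv puv rsub.
split.
- exact: core_contract.
- move=> x; rewrite !inE => Hx; have xv : x != v.
    by case/orP: Hx => [/eqP -> //|/andP[]].
  have /leafP[xG xK Lx] : leaf G p K x.
    case/orP: Hx => [/eqP ->|/andP[_ /rL //]].
    by apply/leafP.
  by apply/leafP; split; rewrite //= ?inE ?xv // => y /setD1P[_]; apply: Lx.
- move=> y; have [->|yu] := eqVneq y (p u).
    apply: (@card_sub_set2 _ u u); apply/subsetP => x; rewrite !inE.
    case/andP=> /orP[-> //|/andP[xv xr]] px.
    by have /(subsetP rsub) : x \in [set x in r | p x == p u];
      rewrite !inE ?xr // (negPf xv) orbF => ->.
  apply: leq_trans (rC y); apply/subset_leq_card/subsetP => x; rewrite !inE.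
  case/andP=> /orP[/eqP ->|/andP[_ ->] //] /eqP E.
  by rewrite E eqxx in yu.
apply: (bounded_contract bG) => //=.
- by move=> x /setD1P[_ xG]; rewrite !inE Lv // (parent_verts bG).
- by move=> x /setD1P[xv _] _ xr; rewrite !inE xv xr orbT.
move=> y /setD1P[yv yG] yu; rewrite !inE eqxx.
case=> E; [by left | | by left; rewrite puv |].
  by have := Lu y yG; rewrite E eqxx.
by have := Lv y yG; rewrite E eqxx.
Qed.

(** Having absorbed its only child, [p v] is a leaf whose parent edge may turn red. No two red
    leaves share a parent, so the parent of [p v] ends with at most two red children. *)
Lemma hairy_prune G p K a d r v : hairy G p K a d r ->
  leaf G p K v -> p v \notin K -> p v != v ->
  {in verts G, forall y, p y = p v -> y = v} ->
  {in r &, injective p} ->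
  hairy (contract G (p v) v) p K a d (p v |: r :\ v).
Proof.
case=> cG rL rC bG /leafP[vG vK Lv] uK uv only injr.
have uG := parent_verts bG vG.
split.
- exact: core_contract.
- move=> x; rewrite !inE => Hx; have xv : x != v.
    by case/orP: Hx => [/eqP -> //|/andP[]].
  apply/leafP; rewrite /= !inE xv /=.
  case/orP: Hx => [/eqP ->|/andP[_ /rL/leafP[xG xK Lx]]]; split=> //.
    by move=> y /setD1P[yv yG]; apply: contraNneq yv => /only ->.
  by move=> y /setD1P[_]; apply: Lx.
- move=> y; case: (pickP [pred x in r | p x == y]) => [x /andP[xr /eqP px]|none].
    apply: (@card_sub_set2 _ (p v) x); apply/subsetP => z; rewrite !inE.
    case/andP=> /orP[-> //|/andP[_ zr]] /eqP pz.
    by rewrite (injr z x) ?eqxx ?orbT // pz.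
  apply: (@card_sub_set2 _ (p v) (p v)); apply/subsetP => z; rewrite !inE.
  case/andP=> /orP[-> //|/andP[_ zr]] pz.
  by have := none z; rewrite /= zr pz.
apply: (bounded_contract bG) => //=.
- by move=> x /setD1P[_ xG]; rewrite !inE Lv // (parent_verts bG).
- by move=> x /setD1P[xv _] _ xr; rewrite !inE xv xr orbT.
move=> y /setD1P[yv yG] yu; rewrite !inE eqxx.
case=> E; first by left.
- by rewrite (only y yG E) eqxx in yv.
- by rewrite E eqxx in yu.
- by have := Lv y yG; rewrite E eqxx.
Qed.

Lemma hairy_sequence G p K a d r : hairy G p K a d r -> sequence_of_width 2 G.
Proof.
move En: #|verts G| => n; elim: n G r En => [|n IH] G r En hG.
  case: hG => -[KG aK _ _ _] _ _ _; have /card_gt0P : 0 < #|verts G|.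
    by apply/card_gt0P; exists a; apply: KG.
  by rewrite (cards0_eq En) => -[x]; rewrite inE.
have deg := hairy_red_degree hG.
have step u v r' : u \in verts G -> v \in verts G -> u != v ->
    hairy (contract G u v) p K a d r' -> sequence_of_width 2 G.
  move=> uG vG uv; move/IH => H.
  apply: (sequence_of_width_contract uG vG uv deg); apply: H.
  by move: En; rewrite (cardsD1 v) vG => -[].
have [cG rL rC bG] := hG; have [KG aK pK injp dp] := cG.
case: (pickP [pred xy | [&& leaf G p K xy.1, leaf G p K xy.2,
    xy.1 != xy.2 & p xy.1 == p xy.2]]) => [[x y] /= /and4P[Lx Ly xy /eqP pxy]|nosib].
  have [||||u [v [/andP[Lu /eqP pu] /andP[Lv /eqP pv] uv rsub]]] :=
    @card2_extend _ [pred z | leaf G p K z & p z == p x] x y (rC (p x)).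
  - by move=> z; rewrite !inE => /andP[/rL ->].
  - by rewrite /= Lx eqxx.
  - by rewrite /= Ly pxy eqxx.
  - exact: xy.
  have [uG _ _] := leafP _ _ _ _ Lu; have [vG _ _] := leafP _ _ _ _ Lv.
  apply: (step u v _ uG vG uv (hairy_merge hG Lu Lv uv _ _)); first by rewrite pu.
  by rewrite pu.
have leaf_inj x y : leaf G p K x -> leaf G p K y -> p x = p y -> x = y.
  move=> Lx Ly pxy; apply/eqP; apply: contraT => xy.
  by have := nosib (x, y); rewrite /= Lx Ly xy pxy eqxx.
have dpK x : x \in verts G -> x \notin K -> d (p x) < d x.
  by move=> xG xK; apply: dp => //; apply: contraNneq xK => ->.
case: (pickP [pred x in verts G | p x \notin K]) => [x0 Px0|flat].
  (* The parent of [v] is deepest among the parents off [K]. A child of [p v] with a child of its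
     own would be a deeper one, so all children of [p v] are leaves; without sibling leaves, [v] is
     the only child. *)
  case: (arg_maxnP (fun x => d (p x)) Px0) => v /andP[vG pvK] vmax.
  have notK y : p y \notin K -> y \notin K by apply: contraNN; apply: pK.
  have Lsib y : y \in verts G -> p y = p v -> leaf G p K y.
    move=> yG pyv; have yK : y \notin K by rewrite notK // pyv.
    apply/leafP; split=> // z zG; apply/eqP => pz.
    have : d (p z) <= d (p v) by apply: vmax; rewrite /= zG pz.
    by rewrite pz -pyv leqNgt dpK.
  have Lv : leaf G p K v by apply: Lsib.
  have uv : p v != v by case/leafP: Lv => _ _ ->.
  apply: (step (p v) v _ (parent_verts bG vG) vG uv (hairy_prune hG Lv pvK uv _ _)).
    by move=> y yG pyv; apply: leaf_inj => //; apply: Lsib.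
  by move=> y z /rL Ly /rL Lz; apply: leaf_inj.
have pGK x : x \in verts G -> p x \in K.
  by move=> xG; have := flat x; rewrite /= xG => /negbFE.
have LK x : x \in verts G :\: K -> leaf G p K x.
  move=> /setDP[xG xK]; apply/leafP; split=> // y yG.
  by apply: contraNneq xK => <-; apply: pGK.
(* All parents now lie on [K] and no two pendant vertices share one. Absorbing a pendant vertex of
   [a] may redden both cycle edges at [a], which [sun_red] allows. *)
case: (pickP [pred l in verts G :\: K | p l == a]) => [l /andP[lGK /eqP pl]|nol].
  have [lG lK] := setDP lGK; have aG := KG _ aK.
  have al : a != l by apply: contraNneq lK => <-.
  have sub x : x \in (verts G :\ l) :\: K -> (x != l) && (x \in verts G :\: K).
    by rewrite !inE => /and3P[-> -> ->].
  apply: (sequence_of_width_contract aG lG al deg).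
  apply: (@sun_sequence _ p K a d); split; rewrite /=.
  - exact: core_contract.
  - by move=> x /setD1P[_]; apply: pGK.
  - by move=> x y /sub/andP[_ /LK Lx] /sub/andP[_ /LK Ly]; apply: leaf_inj.
  - move=> x /sub/andP[xl /LK Lx]; apply: contraNneq xl => px.
    by apply/eqP/leaf_inj => //; [apply: LK | rewrite px].
  have Lout x : x \in verts G -> p x != l.
    by move=> xG; apply: contraNneq lK => <-; apply: pGK.
  apply: (bounded_contract bG) => //=.
  + by move=> x /setD1P[_ xG]; rewrite !inE Lout // KG // pGK.
  + by move=> x _ _ /rL/leafP[_ xK _]; rewrite inE xK.
  move=> y /setD1P[yl yG] ya; rewrite !inE eqxx orbT.
  case=> E; [by left | by right; rewrite E eqxx !orbT | |].
    by rewrite -E pl eqxx in ya.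
  by have := Lout y yG; rewrite E eqxx.
apply: (@sun_sequence _ p K a d); split=> //.
- by move=> x y /LK Lx /LK Ly; apply: leaf_inj.
- by move=> x xGK; have := nol x; rewrite /= xGK => /= ->.
case: bG => irr pG adjP redP; split=> // x y xG yG xy /(redP x y xG yG xy).
by case=> -[/rL/leafP[_ zK _] E]; [left|right]; rewrite inE zK.
Qed.

End Reduction.

(** * From one feedback edge to a functional graph with one cycle *)

Theorem theorem22 (V : finType) (e : rel V)
    (e_sym : symmetric e) (e_irr : irreflexive e) :
  feedback_edge_number e = 1 -> twin_width e <= 2.
Proof.
have [F /andP[Fe acyc] [-> _]] := feedback_edge_numberP e.
move/eqP/cards1P=> [f Ff].
have /imsetP[[a b] /= eab fab] : f \in edges e.
  by apply: (subsetP Fe); rewrite Ff inE.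
rewrite inE /= in eab; rewrite /= in fab.
pose T := del_edges e F.
have T_sym : symmetric T by move=> x y; rewrite /T /del_edges /= e_sym setUC.
have T_irr : irreflexive T by move=> x; rewrite /T /del_edges /= e_irr.
have [q [d [dq Tq]]] := acyclic_parent T_sym T_irr acyc a.
(* Closing the tree by the arc from its root [a] to [b] turns it into a
   functional graph whose only cycle goes through [a]. *)
pose p x := if x == a then b else q x.
have dp x : x != a -> d (p x) < d x by move=> xa; rewrite /p (negPf xa) dq.
have reach x : fconnect p x a.
  have [k] := ubnP (d x); elim: k x => // k IH x dxk.
  have [->|xa] := eqVneq x a; first exact: connect0.
  apply: connect_trans (fconnect1 p x) (IH _ _).
  exact: leq_trans (dp x xa) _.
have edge x y : e x y -> p x = y \/ p y = x.
  move=> exy; have [inF|notF] := boolP ([set x; y] \in F).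
    have E : [set x; y] = [set a; b] by move: inF; rewrite Ff inE fab => /eqP.
    have xy : x != y by apply: contraTneq exy => ->; rewrite e_irr.
    have: (x \in [set a; b]) && (y \in [set a; b]) by rewrite -E !inE !eqxx orbT.
    rewrite !inE /p; case/andP=> /orP[]/eqP Ex /orP[]/eqP Ey; subst x y;
      rewrite ?eqxx in xy *; by [left|right|].
  have [|[xa qx]|[ya qy]] := Tq x y; first by rewrite /T /del_edges /= exy.
    by left; rewrite /p (negPf xa).
  by right; rewrite /p (negPf ya).
have [|s _ [-> smin]] := twin_widthP e; first by apply/card_gt0P; exists a.
suff [s' Hs' Ws'] : sequence_of_width 2 (trigraph_of e).
  exact: leq_trans (smin _ Hs') Ws'.
(* The cycle is the orbit of [a], and the red set is empty because the initial trigraph has no red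
   edge. *)
apply: (@hairy_sequence _ _ p [set x | fconnect p a x] a d set0); split.
- split.
  + by move=> x _; apply: in_setT.
  + by rewrite inE connect0.
  + by move=> x; rewrite !inE => /connect_trans; apply; apply: fconnect1.
  + move=> x y; rewrite !inE !fconnect_orbit.
    (* [a] is reached again from [p a], which makes [p] injective on the orbit of [a]. *)
    by apply: (orbitPcycle 2 5).1; apply: reach.
  + by move=> x _; apply: dp.
- by move=> x; rewrite inE.
- by move=> y; rewrite (_ : [set _ in _ | _] = set0) ?cards0 //;
    apply/setP => x; rewrite !inE.
split=> [x|x _|x y _ _ _|x y _ _ _] //.
by rewrite /adj /= orbF; apply: edge.
Qed.
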